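(* Let $K$ be a Polish space, let $f:K\to\mathbb{R}$ be a function, and let $f_1,f_2,\ldots$ be functions in $\mathrm{DSC}(K)$. Suppose that for every countable ordinal $\alpha$ and every non-empty closed subset $L$ of $K$, there exist a subsequence $(f'_j)$ of $(f_j)$ and a closed relative neighborhood $U$ in $L$ such that (i) $f'_j\to f$ uniformly on $U$, and (ii) $\sum_j \big\|\mathrm{osc}_\alpha\big((f'_{j+1}-f'_j)|_U\big)\big\|_\infty<\infty$. Then $f\in \mathrm{DSC}(K)$.
   Context: $C(K)$ is the class of continuous functions $K\to\mathbb{R}$. $\mathrm{DSC}(K)$ is the set of $f:K\to\mathbb{R}$ for which there is a sequence $(f_n)\subset C(K)$ with $f_n\to f$ pointwise and $\sum_{n=1}^\infty|f_{n+1}(k)-f_n(k)|<\infty$ for every $k\in K$ (equivalently, the differences of two real-valued semi-continuous functions on $K$). A closed relative neighborhood in $L$ is a closed subset $U$ of $L$ having non-empty interior relative to $L$. $\|\cdot\|_\infty$ is the supremum of absolute values over $U$ (possibly $\infty$). Transfinite oscillations: let $X$ be a Polish space (e.g. a closed subset of $K$ with the relative topology). For $g:X\to[-\infty,\infty]$ and $x\in X$, $\limsup_{y\to x}g(y)$ denotes the unrestricted limsup $\inf_V\sup g(V)$, the infimum over all open neighborhoods $V$ of $x$ in $X$ (so $y=x$ is allowed), and the upper semi-continuous envelope of $g$ is $\mathbf{U}g(x)=\limsup_{y\to x}g(y)$. For $h:X\to\mathbb{R}$ define $\mathrm{osc}_\alpha h:X\to[0,\infty]$ for ordinals $\alpha<\omega_1$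 by induction: $\mathrm{osc}_0h\equiv0$; if $\beta=\alpha+1$, put $\widetilde{\mathrm{osc}}_\beta h(x)=\limsup_{y\to x}\big(|h(y)-h(x)|+\mathrm{osc}_\alpha h(y)\big)$ for all $x\in X$; if $\beta$ is a limit ordinal, put $\widetilde{\mathrm{osc}}_\beta h=\sup_{\alpha<\beta}\mathrm{osc}_\alpha h$; in both cases $\mathrm{osc}_\beta h=\mathbf{U}\,\widetilde{\mathrm{osc}}_\beta h$. For a function restricted to $U$ these are computed in the space $U$. *)

(* Defs.v *)
From HB Require Import structures.
From mathcomp Require Import all_boot all_order all_algebra.
From mathcomp Require Import all_classical all_reals all_analysis.
From mathcomp Require Import wochoice.
Set Implicit Arguments.
Unset Strict Implicit.
Unset Printing Implicit Defensive.
Import Order.TTheory GRing.Theory Num.Theory.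
Import numFieldNormedType.Exports.
Local Open Scope classical_set_scope.
Local Open Scope ring_scope.

Definition distance_on (R : realType) (T : Type) (d : T -> T -> R) : Prop :=
  [/\ forall x y, 0 <= d x y,
      forall x y, d x y = 0 <-> x = y,
      forall x y, d x y = d y x &
      forall x y z, d x z <= d x y + d y z].

Definition distance_induces_topology (R : realType) (T : topologicalType)
    (d : T -> T -> R) : Prop :=
  forall (x : T) (A : set T),
    nbhs x A <-> exists2 e : R, 0 < e & [set y | d x y < e] `<=` A.

Definition complete_distance (R : realType) (T : topologicalType)
    (d : T -> T -> R) : Prop :=
  forall u : nat -> T,
    (forall e : R, 0 < e -> exists N : nat, forall m n : nat,
        (N <= m)%N -> (N <= n)%N -> d (u m) (u n) < e) ->
    exists l : T, u n @[n --> \oo] --> l.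

Definition polish_space (R : realType) (T : topologicalType) : Prop :=
  (exists2 D : set T, countable D & dense D) /\
  (exists d : T -> T -> R,
     [/\ distance_on d, distance_induces_topology d & complete_distance d]).

Definition DSC (R : realType) (K : topologicalType) (f : K -> R) : Prop :=
  exists u : nat -> K -> R,
    [/\ forall n, continuous (u n),
        forall k, u n k @[n --> \oo] --> f k &
        forall k, (\sum_(0 <= n <oo) `|u n.+1 k - u n k|%:E < +oo)%E].

Definition closed_relative_neighborhood (K : topologicalType)
    (L U : set K) : Prop :=
  [/\ U `<=` L,
      exists2 C : set K, closed C & U = C `&` L &
      exists2 V : set K, open V & (V `&` L) !=set0 /\ V `&` L `<=` U].

Definition strictly_increasing (phi : nat -> nat) : Prop :=
  {homo phi : m n / (m < n)%N}.

(** The norm takes values in [\bar R]: it is [+oo] for unbounded functions. *)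
Definition sup_norm (R : realType) (X : Type) (g : X -> \bar R) : \bar R :=
  ereal_sup (range (fun x => `|g x|%E)).

Definition strict_of (W : countType) (le : rel W) : W -> W -> Prop :=
  fun b a => le b a /\ b <> a.

Lemma strict_of_wf (W : countType) (le : rel W) :
  well_order le -> well_founded (strict_of le).
Proof.
move=> wo; apply: contrapT => nwf.
have [a na] : exists a, ~ Acc (strict_of le) a by apply/existsNP.
have [|z [[zA zmin] _]] := wo [pred x | ~~ `[< Acc (strict_of le) x >]].
  by exists a; rewrite inE; apply/asboolPn.
move: zA; rewrite inE => /asboolPn; apply; constructor => b [lebz bz].
apply: contrapT => nb; apply: bz.
have lezb : le z b by apply: zmin; rewrite inE; apply/asboolPn.
have refl x : le x x.
  have [|t [[+ tmin] _]] := wo (pred1 x); first by exists x; rewrite inE.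
  by rewrite inE => /eqP tx; rewrite -{1}tx; apply: tmin; rewrite inE.
have [|t [_ tuniq]] := wo (pred2 b z); first by exists b; rewrite !inE eqxx.
transitivity t; last first.
  by apply: tuniq; split=> [|x]; rewrite !inE ?eqxx ?orbT// => /orP[]/eqP->.
apply/esym/tuniq; split=> [|x]; rewrite !inE ?eqxx// => /orP[]/eqP->//.
Qed.

Definition is_zero_at (W : countType) (le : rel W) (a : W) : Prop :=
  forall b, ~ strict_of le b a.

Definition is_succ_of (W : countType) (le : rel W) (b a : W) : Prop :=
  strict_of le b a /\ forall c, ~ (strict_of le b c /\ strict_of le c a).

(** An ordinal [alpha < omega_1] is represented by a point [a] of a countable
    well-ordered type: [alpha] is the order type of the strict initial segment
    below [a].  Every countable ordinal arises in this way (as the last point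
    of a well-order of type [alpha + 1]), and the ordinals below [alpha] are
    represented by the points strictly below [a]. *)
Record countable_ordinal := CountableOrdinal {
  ord_carrier : countType ;
  ord_le : rel ord_carrier ;
  ord_wo : well_order ord_le ;
  ord_point : ord_carrier
}.

(** The filter is [nbhs x] and not the punctured [x^'], so that the point [x]
    itself is taken into account. *)
Definition limsup_at (R : realType) (X : topologicalType) (g : X -> \bar R)
    (x : X) : \bar R :=
  limf_esup g (nbhs x).

Definition usc_envelope (R : realType) (X : topologicalType)
    (g : X -> \bar R) : X -> \bar R :=
  fun x => limsup_at g x.

Section Oscillation.
Variables (R : realType) (X : topologicalType) (h : X -> R).

Definition osc_succ (g : X -> \bar R) : X -> \bar R :=
  usc_envelope (fun x => limsup_at (fun y => `|h y - h x|%:E + g y)%E x).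

Section AtPoint.
Variables (W : countType) (le : rel W) (wo : well_order le).

Definition osc_step (a : W)
    (rec : forall b, strict_of le b a -> X -> \bar R) : X -> \bar R :=
  if pselect (is_zero_at le a) then fun=> 0%:E
  else match pselect (exists b, is_succ_of le b a) with
  | left ex => osc_succ (rec (projT1 (cid ex)) (proj1 (projT2 (cid ex))))
  | right _ => usc_envelope (fun x =>
      ereal_sup [set z | exists b (ba : strict_of le b a), z = rec b ba x])
  end.

Definition osc_at : W -> X -> \bar R :=
  Fix (strict_of_wf wo) (fun=> X -> \bar R) osc_step.

Lemma osc_atE (a : W) :
  osc_at a = osc_step (fun b (_ : strict_of le b a) => osc_at b).
Proof.
apply: (Fix_eq (strict_of_wf wo) (fun=> X -> \bar R)) => x f g fg.
by congr osc_step; apply/functional_extensionality_dep => b; apply/funext => p.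
Qed.

Lemma osc_at_zero (a : W) : is_zero_at le a -> osc_at a = fun=> 0%:E.
Proof. by move=> a0; rewrite osc_atE /osc_step; case: pselect. Qed.

Lemma osc_at_succ (a b : W) : is_succ_of le b a ->
  osc_at a = osc_succ (osc_at b).
Proof.
move=> ba; rewrite osc_atE /osc_step.
case: (pselect (is_zero_at le a)) => [a0|a0]; first by exfalso; exact: (a0 b (proj1 ba)).
case: pselect => [ex|nex]; last by exfalso; apply: nex; exists b.
move: (cid ex) => [c ca] /=; congr (osc_succ (osc_at _)).
apply: contrapT => cb.
have [|t [[+ tmin] _]] := @wo (pred2 b c); first by exists b; rewrite !inE eqxx.
have [[ba1 bmin] [ca1 cmin]] := (ba, ca).
have bt := tmin b; have ct := tmin c; rewrite !inE !eqxx/= ?orbT in bt ct.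
rewrite !inE => /orP[/eqP tb|/eqP tc]; subst t.
- by apply: (bmin c); split=> //; split; [exact: ct|move/esym].
- by apply: (cmin b); split=> //; split; [exact: bt|].
Qed.

Lemma osc_at_limit (a : W) :
  ~ is_zero_at le a -> ~ (exists b, is_succ_of le b a) ->
  osc_at a = usc_envelope (fun x =>
    ereal_sup [set osc_at b x | b in [set b | strict_of le b a]]).
Proof.
move=> a0 aS; rewrite osc_atE /osc_step.
case: (pselect (is_zero_at le a)) => [/a0//|na0].
case: (pselect (exists b, is_succ_of le b a)) => [ex|nex].
  by exfalso; exact: aS.
congr usc_envelope; apply/funext => x; congr ereal_sup.
apply/seteqP; split=> z /=; first by move=> [b [ba ->]]; exists b.
by move=> [b ba <-]; exists b, ba.
Qed.

End AtPoint.

Definition osc (alpha : countable_ordinal) : X -> \bar R :=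
  osc_at (@ord_wo alpha) (ord_point alpha).

End Oscillation.

(* Main.v *)
Require Import Defs.
From HB Require Import structures.
From mathcomp Require Import all_boot all_order all_algebra.
From mathcomp Require Import all_classical all_reals all_analysis.
From mathcomp Require Import wochoice lra.
Set Implicit Arguments.
Unset Strict Implicit.
Unset Printing Implicit Defensive.
Import Order.TTheory GRing.Theory Num.Theory.
Import numFieldNormedType.Exports.
Local Open Scope classical_set_scope.
Local Open Scope ring_scope.

(** Why the theorem holds.

    Fix a non-empty closed set [L].  Each transfinite sequence of oscillations
    of a function on [L] is a nondecreasing sequence of upper semicontinuous
    functions; since [L] is second countable it is stationary from some
    countable ordinal on, and a single countable ordinal [alpha] serves for the
    countably many differences [f_i - f_j] restricted to [L]
    ([osc_stationary]).  Apply the hypothesis to [alpha] and [L]: it gives a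
    subsequence [g_j] and a closed relative neighborhood [U], say with
    [V `&` L `<=` U] for an open [V] meeting [L].  Oscillations are local, so on
    [V `&` L] the functions [G_j], the oscillations of order [alpha] of
    [g_(j+1) - g_j] computed in [U], are still stationary ([portion_osc]):

      limsup_(y -> x) (|(g_(j+1) - g_j)(y) - (g_(j+1) - g_j)(x)| + G_j(y))
        <= G_j(x).

    These inequalities add up.  As the sum [S] of the [G_j] and the limit of
    [g_n] are both uniform on [U], the same inequality holds for [f - g_0] and
    [S] ([variation_limit]), which means that [S + (f - g_0)] and
    [S - (f - g_0)] are upper semicontinuous on [V `&` L].  Since [g_0] is a
    difference of semicontinuous functions, so is [f] on [V `&` L].

    Thus every non-empty closed [L] has a non-empty relatively open portion on
    which [f] is a difference of lower semicontinuous functions, and this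
    portion, after shrinking, is a countable union of closed sets on which the
    two functions are bounded ([portion_sigma_piece]).  By the Lindelof property
    the whole space is a countable union of such closed pieces
    ([DSC_of_portions]), and the representations on the pieces can be glued into
    a global one by adding the same fast growing constants to both functions
    ([sigma_piece_lsc]).  Finally, nonnegative lower semicontinuous functions
    are increasing limits of continuous ones by inf-convolution, so [f] is in
    DSC ([lsc_DSC]). *)

(** * Towers of an increasing operator *)

(** [F] is a nondecreasing inflationary operator on the ordered set [Z] and [cl]
    is a subset stable under [F].  [E S] bounds [S] above, and is below every
    upper bound of [S] that lies in [cl]. *)
Section Tower.
Variables (Z : Type) (le : Z -> Z -> Prop) (F : Z -> Z) (E : set Z -> Z).
Variable cl : set Z.
Hypothesis le_trans : forall y x z, le x y -> le y z -> le x z.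
Hypothesis le_anti : forall x y, le x y -> le y x -> x = y.
Hypothesis F_mono : forall x y, le x y -> le (F x) (F y).
Hypothesis F_infl : forall x, le x (F x).
Hypothesis E_ub : forall S x, S x -> le x (E S).
Hypothesis E_lub : forall S b, cl b -> (forall x, S x -> le x b) -> le (E S) b.
Hypothesis cl_F : forall x, cl x -> cl (F x).
Hypothesis cl_E : forall S, S `<=` cl -> cl (E S).

(** The least class of points containing the supremum of each of its subsets and
    closed under [F].  [E S] plays the role of the supremum of [S] among the
    points of [cl]; in particular [E set0] is the bottom of the tower, so that
    the tower consists of the transfinite iterates of [F]. *)
Inductive tower : set Z :=
| tower_step x : tower x -> tower (F x)
| tower_sup S : (forall x, S x -> tower x) -> tower (E S).

Lemma tower_closed x : tower x -> cl x.
Proof. by elim=> [y _|S _]; [exact: cl_F|exact: cl_E]. Qed.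

(** The tower is linearly ordered, and there is nothing strictly between [y] and
    [F y].  Both instances of the dichotomy are carried through the induction:
    the case of [F c] on one side needs the reversed statement for [c]. *)
Lemma tower_step_linear x y : tower x -> tower y -> le x y \/ le (F y) x.
Proof.
suff H : tower x -> forall y, tower y ->
    (le x y \/ le (F y) x) /\ (le y x \/ le (F x) y).
  by move=> tx ty; case: (H tx _ ty).
move=> {y}; elim=> {x} [c tc IH|S tS IH] y ty.
- split.
    have [_ [yc|Fcy]] := IH _ ty; last by left.
    by right; exact: F_mono.
  elim: ty => {y} [d td IHd|S tS IHS].
    by have [_ [dc|Fcd]] := IH _ td; [left|right]; exact: F_mono.
  have [[s Ss Fs]|nS] := pselect (exists2 s, S s & le (F (F c)) s).
    by right; apply: (le_trans Fs); exact: E_ub.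
  left; apply: E_lub; first exact/cl_F/tower_closed.
  move=> s Ss; have [//|FFs] := IHS _ Ss.
  by exfalso; apply: nS; exists s.
- have D z : tower z -> le (E S) z \/ le (F z) (E S).
    move=> tz; have [[s Ss Fzs]|nS] := pselect (exists2 s, S s & le (F z) s).
      by right; apply: (le_trans Fzs); exact: E_ub.
    left; apply: E_lub; first exact: tower_closed.
    move=> s Ss; have [[//|Fzs] _] := IH _ Ss _ tz.
    by exfalso; apply: nS; exists s.
  split; first exact: D.
  elim: ty => {y} [d td _|S' tS' IHS'].
    by have [Sd|] := D _ td; [right; exact: F_mono|left].
  have [[s Ss FSs]|nS] := pselect (exists2 s, S' s & le (F (E S)) s).
    by right; apply: (le_trans FSs); exact: E_ub.
  left; apply: E_lub; first exact/cl_E/(fun x Sx => tower_closed (tS x Sx)).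
  move=> s Ss; have [//|FSs] := IHS' _ Ss.
  by exfalso; apply: nS; exists s.
Qed.

Lemma tower_fixpoint_max m x : tower m -> F m = m -> tower x -> le x m.
Proof.
move=> tm Fm; elim=> {x} [c _ cm|S _ IH]; first by rewrite -Fm; exact: F_mono.
by apply: E_lub => //; exact: tower_closed.
Qed.

(** The tower is well-ordered: the least element of [P] is the supremum of its
    lower bounds in the tower. *)
Lemma tower_min (P : set Z) : P `<=` tower -> P !=set0 ->
  exists2 m, P m & forall p, P p -> le m p.
Proof.
move=> Pt [p0 Pp0]; pose S := [set t | tower t /\ forall p, P p -> le t p].
have tm : tower (E S) by apply: tower_sup => x [].
have mP p : P p -> le (E S) p.
  by move=> Pp; apply: E_lub => [|x [_]]; [exact/tower_closed/Pt|exact].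
exists (E S) => //; apply: contrapT => nPm.
have neq p : P p -> p <> E S by move=> Pp pm; apply: nPm; rewrite -pm.
have FmP p : P p -> le (F (E S)) p.
  move=> Pp; have [pm|//] := tower_step_linear (Pt _ Pp) tm.
  by exfalso; apply: (neq _ Pp); apply: le_anti => //; exact: mP.
have Fm : F (E S) = E S.
  apply: le_anti => //; apply: E_ub; split=> //; exact: tower_step.
by apply: (neq _ Pp0); apply: le_anti; [exact/tower_fixpoint_max/Pt|exact: mP].
Qed.

(** A tower that injects into a countable type is itself, with its order, a
    countable well-ordered type.  Its inclusion [v] satisfies the recursion
    that defines the transfinite iteration of [F], and its last point is a
    fixed point of [F]. *)
Lemma tower_countable_ordinal (C : countType) (code : Z -> C) :
  (forall x y, tower x -> tower y -> code x = code y -> x = y) ->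
  exists (alpha : countable_ordinal) (v : ord_carrier alpha -> Z),
    let lt := strict_of (@ord_le alpha) in
    [/\ forall a, tower (v a),
        forall a, is_zero_at (@ord_le alpha) a -> v a = E set0,
        forall a b, is_succ_of (@ord_le alpha) b a -> v a = F (v b),
        forall a, ~ is_zero_at (@ord_le alpha) a ->
          ~ (exists b, is_succ_of (@ord_le alpha) b a) ->
          v a = E [set v b | b in [set b | lt b a]] &
        F (v (ord_point alpha)) = v (ord_point alpha)].
Proof.
move=> code_inj; pose W := {x | tower x}.
pose f (w : W) : C := code (sval w).
have vinj (w w' : W) : sval w = sval w' -> w = w'.
  case: w w' => [x p] [y q] /= xy; subst y.
  by congr exist; exact: Prop_irrelevance.
pose g (c : C) : option W :=
  if pselect (exists w, f w = c) is left ex then Some (projT1 (cid ex))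
  else None.
have fK : pcancel f g.
  move=> w; rewrite /g; case: pselect => [ex|[]]; last by exists w.
  congr Some; case: cid => w' /= ww'; apply: vinj; apply: code_inj ww'.
    exact: (svalP w').
  exact: (svalP w).
pose V : countType := pcan_type fK.
pose v (w : V) : Z := sval (w : W).
have tv w : tower (v w) by exact: (svalP (w : W)).
have surj x : tower x -> exists w, v w = x by move=> tx; exists (exist _ x tx).
pose leW : rel V := fun a b => `[< le (v a) (v b) >].
have wo : well_order leW.
  apply: antisymmetric_well_order.
    move=> a b /andP[/asboolP ab /asboolP ba]; apply: vinj.
    exact: le_anti.
  move=> A [a Aa].
  have [||m [b Ab <-] mP] := @tower_min [set v b | b in [set b | b \in A]].
  - by move=> _ [b _ <-].
  - by exists (v a), a.
  - exists b; split=> // c Ac; apply/asboolP; apply: mP; by exists c.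
(* The last point is the supremum of the whole tower. *)
have ttop : tower (E tower) by apply: tower_sup.
have [top vtop] := surj _ ttop.
exists (CountableOrdinal wo top), v => lt /=.
have ltP a b : lt a b <-> le (v a) (v b) /\ v a <> v b.
  split=> [[/asboolP ab ne]|[ab ne]].
    by split=> // vab; apply: ne; exact: vinj.
  by split; [exact/asboolP|move=> abe; apply: ne; rewrite abe].
(* Otherwise [F (v b)] would be strictly between [v b] and [v a]. *)
have succP b a : is_succ_of leW b a -> v a = F (v b).
  move=> [/ltP[leba neba] nb].
  have [ab|Fba] := tower_step_linear (tv a) (tv b).
    by exfalso; apply: neba; exact: le_anti.
  apply: contrapT => aFb.
  have [c vc] := surj _ (tower_step (tv b)).
  apply: (nb c); split; apply/ltP; rewrite vc; split=> //; last first.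
    by move=> eq; apply: aFb.
  move=> eq; apply: neba; apply: le_anti => //.
  by apply: tower_fixpoint_max.
have botP : forall x, tower x -> le (E set0) x.
  by move=> x tx; apply: E_lub => //; exact: tower_closed.
split=> //.
- move=> a a0; apply: contrapT => ne.
  have [z vz] : exists z, v z = E set0 by apply: surj; exact: tower_sup.
  by apply: (a0 z); apply/ltP; rewrite vz; split; [exact: botP|exact/nesym].
- by move=> a b /succP.
- move=> a _ nsucc; set S := [set v b | b in _].
  have tS : tower (E S) by apply: tower_sup => _ [b _ <-].
  have Sa : le (E S) (v a).
    by apply: E_lub => [|_ [b /ltP[ba _] <-]//]; exact: tower_closed.
  apply: contrapT => ne; apply: nsucc.
  have [m vm] := surj _ tS.
  exists m; split; first by apply/ltP; rewrite vm; split=> //; exact/nesym.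
  move=> c [/ltP[mc nmc] /ltP[ca nca]]; apply: nmc; apply: le_anti => //.
  by rewrite vm; apply: E_ub; exists c => //; exact/ltP.
- rewrite vtop; apply: le_anti => //; apply: E_ub; exact: tower_step.
Qed.

End Tower.

(** * Upper semicontinuity and stationarity of the oscillations *)

Section Limsup.
Variables (R : realType) (X : topologicalType).
Implicit Types (g b : X -> \bar R) (h : X -> R) (x : X) (r : \bar R).
Local Open Scope ereal_scope.

Lemma limsup_at_lt g x r : limsup_at g x < r -> \forall y \near x, g y < r.
Proof.
move=> /ereal_inf_lt[_ [V Vx <-] Vr]; apply: filterS Vx => y Vy.
by apply: le_lt_trans Vr; apply: ereal_sup_ubound; exists y.
Qed.

Lemma limsup_at_le g x r : (\forall y \near x, g y <= r) -> limsup_at g x <= r.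
Proof.
move=> gr; apply: le_trans (_ : ereal_sup (g @` [set y | g y <= r]) <= r).
  by apply: ereal_inf_lbound; exists [set y | g y <= r].
by apply: ge_ereal_sup => _ [y /= gy <-].
Qed.

Lemma limsup_at_ge g x : g x <= limsup_at g x.
Proof.
apply: le_ereal_inf_tmp => _ [V Vx <-]; apply: ereal_sup_ubound.
by exists x => //; exact: nbhs_singleton.
Qed.

Lemma limsup_at_mono g g' x :
  (\forall y \near x, g y <= g' y) -> limsup_at g x <= limsup_at g' x.
Proof.
move=> gg'; apply: le_ereal_inf_tmp => _ [V Vx <-].
apply: le_trans (_ : ereal_sup (g @` (V `&` [set y | g y <= g' y])) <= _).
  apply: ereal_inf_lbound; exists (V `&` [set y | g y <= g' y]) => //.
  exact: filterI.
apply: ge_ereal_sup => _ [y /= [Vy gy] <-]; apply: le_trans gy _.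
by apply: ereal_sup_ubound; exists y.
Qed.

(** Upper semicontinuity.  As [g x <= limsup_at g x] always holds, the
    inequality amounts to equality. *)
Definition usc g := forall x, limsup_at g x <= g x.

Lemma usc_lt g x r : usc g -> g x < r -> \forall y \near x, g y < r.
Proof. by move=> ug gr; apply: limsup_at_lt; apply: le_lt_trans gr. Qed.

Lemma usc_envelope_usc g : usc (usc_envelope g).
Proof.
move=> x; apply: le_ereal_inf_tmp => _ [V Vx <-].
apply: limsup_at_le; apply: filterS (nbhs_interior Vx) => y Vy.
by apply: ereal_inf_lbound; exists V.
Qed.

Lemma usc_envelope_le g b : usc b -> (forall x, g x <= b x) ->
  forall x, usc_envelope g x <= b x.
Proof.
move=> ub gb x; apply: le_trans (ub x); apply: limsup_at_mono.
exact: nearW.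
Qed.

Lemma osc_succ_infl h g x : g x <= osc_succ h g x.
Proof.
apply: le_trans (limsup_at_ge _ _); apply: le_trans (limsup_at_ge _ _).
by rewrite subrr normr0 add0e.
Qed.

Lemma osc_succ_mono h g g' : (forall x, g x <= g' x) ->
  forall x, osc_succ h g x <= osc_succ h g' x.
Proof.
move=> gg' x; apply: limsup_at_mono; apply: nearW => y; apply: limsup_at_mono.
by apply: nearW => z; rewrite leeD2l.
Qed.

End Limsup.

Lemma rat_between (R : realType) (a b : \bar R) : (a < b)%E ->
  exists q : rat, (a < (ratr q)%:E)%E /\ ((ratr q)%:E < b)%E.
Proof.
have H (r s : R) : r < s -> exists q : rat, r < ratr q /\ ratr q < s.
  by move=> /rat_in_itvoo[q]; rewrite in_itv => /andP[]; exists q.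
move: a b => [r||] [s||] //=; rewrite ?lte_fin ?ltxx //.
- by move=> /H[q ?]; exists q; rewrite !lte_fin.
- move=> _; have /H[q [rq _]] : r < r + 1 by rewrite ltrDl.
  by exists q; rewrite lte_fin ltry.
- move=> _; have /H[q [_ qs]] : s - 1 < s by rewrite gtrBl.
  by exists q; rewrite lte_fin ltNyr.
- by move=> _; exists 0; rewrite ltry ltNyr.
Qed.

Section Stable.
Variables (R : realType) (X : topologicalType) (I : countType).
Variable (h : I -> X -> R).
Variable B : nat -> set X.
Hypothesis Bbase : forall x A, nbhs x A -> exists n, B n x /\ B n `<=` A.
Local Open Scope ereal_scope.

(** The tower is built simultaneously for the whole family [h]: its points are
    families of functions indexed by [I], ordered pointwise, and the supremum of
    [S] is the upper semicontinuous envelope of the pointwise supremum.  The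
    value [0] is put among the values so that the supremum of the empty set is
    the oscillation of order zero. *)
Let Z := I -> X -> \bar R.
Let le (g g' : Z) := forall i x, g i x <= g' i x.
Let F (g : Z) : Z := fun i => osc_succ (h i) (g i).
Let E (S : set Z) : Z :=
  fun i => usc_envelope (fun x => ereal_sup (0 |` [set g i x | g in S])).
Let cl : set Z := [set g | forall i, usc (g i) /\ forall x, 0 <= g i x].

Let le_trans y x z : le x y -> le y z -> le x z.
Proof. by move=> xy yz i p; exact: Order.POrderTheory.le_trans (yz _ _). Qed.
Let le_anti x y : le x y -> le y x -> x = y.
Proof.
move=> xy yx; apply/funext => i; apply/funext => p.
by apply/eqP; rewrite eq_le xy yx.
Qed.
Let F_mono x y : le x y -> le (F x) (F y).
Proof. by move=> xy i; exact: osc_succ_mono. Qed.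
Let F_infl x : le x (F x). Proof. by move=> i p; exact: osc_succ_infl. Qed.
Let E_ub S x : S x -> le x (E S).
Proof.
move=> Sx i p; apply: Order.POrderTheory.le_trans (limsup_at_ge _ _).
by apply: ereal_sup_ubound; right; exists x.
Qed.
Let E_lub S b : cl b -> (forall x, S x -> le x b) -> le (E S) b.
Proof.
move=> clb Sb i; have [ub b0] := clb i; apply: usc_envelope_le => // x.
by apply: ge_ereal_sup => _ [->|[g Sg <-]]//; exact: Sb.
Qed.
Let cl_F x : cl x -> cl (F x).
Proof.
move=> clx i; split; first exact: usc_envelope_usc.
move=> p; apply: Order.POrderTheory.le_trans (F_infl _ _ _).
by have [_] := clx i; apply.
Qed.
Let cl_E S : S `<=` cl -> cl (E S).
Proof.
move=> _ i; split; first exact: usc_envelope_usc.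
move=> p; apply: Order.POrderTheory.le_trans (limsup_at_ge _ _).
by apply: ereal_sup_ubound; left.
Qed.

(** [jump z (i, n, q)] says that the value [q] separates [z i] from its
    successor on the basic set [B n]: [z i] is everywhere below [q] there, and
    the successor is somewhere above.  Every [z] that is not a fixed point of
    [F] has a jump, and distinct points of the tower have no jump in common;
    this makes the tower countable. *)
Let jump (z : Z) (t : I * nat * rat) := let: (i, n, q) := t in
  (forall y, B n y -> z i y < (ratr q)%:E) /\
  exists2 x, B n x & (ratr q)%:E < F z i x.

Let code (z : Z) : option (I * nat * rat) :=
  if pselect (exists t, jump z t) is left ex then Some (projT1 (cid ex))
  else None.

Let code_inj x y : tower F E x -> tower F E y -> code x = code y -> x = y.
Proof.
have tcl z : tower F E z -> cl z := @tower_closed _ _ _ _ cl_F cl_E z.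
(* If [z] and [w] had a common jump, its point where [F z] exceeds [q] would
   contradict [w < q]; if neither has one, [z] is a fixed point, hence maximal. *)
have key z w : tower F E z -> tower F E w -> code z = code w -> le (F z) w ->
    le w z.
  move=> tz tw; rewrite /code.
  case: pselect => [ez|nz]; case: pselect => [ew|nw] //.
    case: cid => [[[i n] q] /= jz]; case: cid => t /= jw [ijt] Fzw; subst t.
    have [[_ [p Bp qp]] [+ _]] := (jz, jw) => /(_ p Bp).
    by rewrite ltNge (Order.POrderTheory.le_trans _ (Fzw i p)) // ltW.
  move=> _ _; apply: (tower_fixpoint_max F_mono E_lub cl_F cl_E) => //.
  apply: le_anti => // i p; rewrite leNgt.
  apply/negP => /rat_between[q [zq qF]].
  apply: nz; have [uz _] := tcl _ tz i.
  have [n [Bp Bz]] := Bbase (usc_lt uz zq).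
  by exists (i, n, q); split=> //; exists p.
move=> tx ty cxy.
have lin a b : tower F E a -> tower F E b -> le a b \/ le (F b) a.
  exact: (tower_step_linear le_trans F_mono E_ub E_lub cl_F cl_E).
have yx : le y x.
  have [//|Fxy] := lin _ _ ty tx; exact: key.
have xy : le x y.
  have [//|Fyx] := lin _ _ tx ty; exact: key.
exact: le_anti.
Qed.

(** A single countable ordinal at which the oscillations of countably many
    functions have all become stationary. *)
Lemma osc_stationary : exists alpha : countable_ordinal,
  forall i, osc_succ (h i) (osc (h i) alpha) = osc (h i) alpha.
Proof.
have [alpha [v [tv v0 vS vlim vtop]]] :=
  tower_countable_ordinal le_trans le_anti F_mono F_infl E_ub E_lub
    cl_F cl_E code_inj.
exists alpha => i.
suff vE a : v a i = osc_at (h i) (@ord_wo alpha) a.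
  by rewrite /osc -vE -[in RHS]vtop.
elim/(well_founded_ind (strict_of_wf (@ord_wo alpha))): a => a IH.
have [a0|na0] := pselect (is_zero_at (@ord_le alpha) a).
  rewrite osc_at_zero // v0 //; apply/funext => x.
  apply/eqP; rewrite eq_le; apply/andP; split.
    apply: limsup_at_le; apply: nearW => y.
    by apply: ge_ereal_sup => _ [->//|[g []]].
  by apply: (cl_E _ i).2.
have [[b ba]|nS] := pselect (exists b, is_succ_of (@ord_le alpha) b a).
  by rewrite (osc_at_succ _ _ ba) (vS _ _ ba) /F IH //; case: ba.
rewrite osc_at_limit // vlim // /E; congr usc_envelope; apply/funext => x.
apply/eqP; rewrite eq_le; apply/andP; split; last first.
  apply: ge_ereal_sup => _ [b ba <-]; apply: ereal_sup_ubound; right.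
  by exists (v b); [exists b|rewrite IH].
apply: ge_ereal_sup => _ [->|[_ [b ba <-] <-]]; last first.
  by apply: ereal_sup_ubound; exists b => //; rewrite IH.
have [b ba] : exists b, strict_of (@ord_le alpha) b a.
  by apply: contrapT => nb; apply: na0 => b ba; apply: nb; exists b.
apply: Order.POrderTheory.le_trans (_ : v b i x <= _).
  by have [_] := tower_closed cl_F cl_E (tv b) i; apply.
by apply: ereal_sup_ubound; exists b => //; rewrite IH.
Qed.

End Stable.

(** * Locality of the oscillations *)

(** The map [j] is continuous and open at the points of the open subset [O] of
    [Y]. *)
Section Locality.
Variables (R : realType) (X Y : topologicalType) (j : Y -> X) (O : set Y).
Hypothesis openO : forall u, O u -> nbhs u O.
Hypothesis nbhsO : forall u A, O u -> (nbhs (j u) A <-> nbhs u (j @^-1` A)).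
Local Open Scope ereal_scope.

Lemma limsup_at_local (g : X -> \bar R) (g' : Y -> \bar R) (u : Y) : O u ->
  (forall w, O w -> g' w = g (j w)) -> limsup_at g' u = limsup_at g (j u).
Proof.
move=> Ou gg'; apply/eqP; rewrite eq_le; apply/andP; split.
  apply: le_trans (_ : limsup_at (g \o j) u <= _).
    by apply: limsup_at_mono; apply: filterS (openO Ou) => w /gg' ->.
  apply: le_ereal_inf_tmp => _ [V /(nbhsO _ Ou) Vu <-].
  apply: limsup_at_le; apply: filterS Vu => w Vw.
  by apply: ereal_sup_ubound; exists (j w).
apply: le_ereal_inf_tmp => _ [V Vu <-].
apply: le_trans (_ : ereal_sup (g @` (j @` (O `&` V))) <= _).
  apply: ereal_inf_lbound; exists (j @` (O `&` V)) => //.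
  apply/nbhsO => //; apply: filterS (filterI (openO Ou) Vu) => w OVw.
  by exists w.
apply: ge_ereal_sup => _ [_ [w [Ow Vw] <-] <-].
by apply: ereal_sup_ubound; exists w; rewrite ?gg'.
Qed.

Variable h : X -> R.

Lemma osc_succ_local (g : X -> \bar R) (g' : Y -> \bar R) (u : Y) : O u ->
  (forall w, O w -> g' w = g (j w)) ->
  osc_succ (h \o j) g' u = osc_succ h g (j u).
Proof.
move=> Ou gg'; apply: limsup_at_local => // w Ow.
apply: (@limsup_at_local (fun y => `|h y - h (j w)|%:E + g y)) => // z Oz /=.
by rewrite gg'.
Qed.

Lemma osc_local (alpha : countable_ordinal) (u : Y) : O u ->
  osc (h \o j) alpha u = osc h alpha (j u).
Proof.
rewrite /osc; move: (ord_point alpha) => a.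
elim/(well_founded_ind (strict_of_wf (@ord_wo alpha))): a u => a IH u Ou.
have [a0|na0] := pselect (is_zero_at (@ord_le alpha) a).
  by rewrite !osc_at_zero.
have [[b ba]|nS] := pselect (exists b, is_succ_of (@ord_le alpha) b a).
  rewrite !(osc_at_succ _ _ ba); apply: osc_succ_local => // w Ow.
  by apply: IH => //; case: ba.
rewrite !osc_at_limit //; apply: limsup_at_local => // w Ow.
by congr ereal_sup; apply/seteqP; split=> _ [b ba <-]; exists b; rewrite // IH.
Qed.

End Locality.

Lemma nbhs_set_typeP (X : topologicalType) (U : set X) (u : U) (A : set U) :
  nbhs u A <-> \forall y \near set_val u, forall w : U, set_val w = y -> A w.
Proof.
split.
  rewrite nbhsE => -[_ [[C oC <-] Cu] CA].
  apply: filterS (open_nbhs_nbhs (conj oC Cu)) => y Cy w wy.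
  by apply: CA; rewrite /= wy.
move=> H; have : nbhs u (set_val @^-1`
    [set y | forall w : U, set_val w = y -> A w]).
  exact: (@initial_continuous U X set_val).
by apply: filterS => w /=; exact.
Qed.

(** If the oscillation of order [alpha] of [h] on [L] is stationary, then on the
    relatively open portion [V `&` L] of [U] it agrees with the one computed in
    [U], and so the latter majorizes the local variation of [h] there. *)
Lemma portion_osc (R : realType) (K : topologicalType) (L U V : set K)
    (h : K -> R) (alpha : countable_ordinal) (M : R) :
  U `<=` L -> open V -> V `&` L `<=` U ->
  osc_succ (sigL L h) (osc (sigL L h) alpha) = osc (sigL L h) alpha ->
  (sup_norm (osc (sigL U h) alpha) <= M%:E)%E ->
  exists G : K -> R, (forall x, U x -> `|G x| <= M) /\
    forall x, V x -> L x -> forall e, 0 < e ->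
      \forall y \near x, L y -> `|h y - h x| + G y < G x + e.
Proof.
move=> UL oV VLU stat supM.
pose o := osc (sigL U h) alpha.
have oM u : (`|o u| <= M%:E)%E.
  by apply: le_trans supM; apply: ereal_sup_ubound; exists u.
have ofin u : o u \is a fin_num.
  by rewrite fin_num_abs; apply: le_lt_trans (oM u) _; rewrite ltry.
pose mk (x : K) (Ux : U x) : U := SigSub (mem_set Ux).
(* The oscillation computed in [U], extended by [0] outside [U]. *)
pose G x := if pselect (U x) is left Ux then fine (o (mk x Ux)) else 0.
have Gu (u : U) : (G (set_val u))%:E = o u.
  rewrite /G; case: pselect => [Ux|[]]; last by apply: set_mem; exact: valP.
  by rewrite fineK //; congr o; apply: val_inj.
pose j (u : U) : L := SigSub (mem_set (UL _ (set_mem (valP u)))).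
pose O : set U := [set u | V (set_val u)].
have openO u : O u -> nbhs u O.
  move=> Ou; apply/nbhs_set_typeP; apply: filterS (open_nbhs_nbhs (conj oV Ou)).
  by move=> y Vy w wy; rewrite /O /= wy.
have nbhsO u A : O u -> (nbhs (j u) A <-> nbhs u (j @^-1` A)).
  move=> Ou; split=> /nbhs_set_typeP H; apply/nbhs_set_typeP.
    by apply: filterS H => y H w wy; exact: H.
  apply: filterS2 H (open_nbhs_nbhs (conj oV Ou)) => y H Vy w wy.
  have Uw : U (set_val w).
    by apply: VLU; split; [rewrite wy|apply: set_mem; exact: valP].
  have -> : w = j (mk _ Uw) by apply: val_inj.
  exact: H.
have statO u : O u -> osc_succ (sigL U h) o u = o u.
  move=> Ou; rewrite /o (osc_local openO nbhsO (sigL L h) alpha Ou).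
  rewrite -[RHS](congr1 (@^~ (j u)) stat).
  apply: (osc_succ_local openO nbhsO) => // w Ow.
  exact: (osc_local openO nbhsO (sigL L h) alpha Ow).
exists G; split=> [x Ux|x Vx Lx e e0].
  by have := oM (mk _ Ux); rewrite -Gu lee_fin.
have Ux : U x by apply: VLU.
pose u := mk _ Ux.
have : (limsup_at (fun y => `|sigL U h y - sigL U h u|%:E + o y) u
        < (G x + e)%:E)%E.
  apply: le_lt_trans (_ : osc_succ (sigL U h) o u < _)%E.
    exact: (limsup_at_ge (fun x => limsup_at _ x)).
  by rewrite statO // -Gu lte_fin ltrDl.
move=> /limsup_at_lt /nbhs_set_typeP H.
apply: filterS2 H (open_nbhs_nbhs (conj oV Vx)) => y H Vy Ly.
have Uy : U y by apply: VLU.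
by have := H (mk _ Uy) erefl; rewrite -Gu -EFinD lte_fin.
Qed.

(** * Lower semicontinuous functions and DSC *)

Section LowerSemicontinuity.
Variables (R : realType) (K : topologicalType).
Implicit Types (A : set K) (u v : K -> R).

(** Lower semicontinuity of the restriction of [u] to [A]. *)
Definition lsc_on A u :=
  forall x, A x -> forall e, 0 < e -> \forall y \near x, A y -> u x - e < u y.

Lemma lsc_on_sub A B u : B `<=` A -> lsc_on A u -> lsc_on B u.
Proof.
move=> BA lu x Bx e e0; apply: filterS (lu _ (BA _ Bx) _ e0) => y uy /BA.
exact: uy.
Qed.

Lemma lsc_onD A u v : lsc_on A u -> lsc_on A v -> lsc_on A (fun x => u x + v x).
Proof.
move=> lu lv x Ax e e0; have e20 : 0 < e / 2 by rewrite divr_gt0.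
apply: filterS2 (lu _ Ax _ e20) (lv _ Ax _ e20) => y uy vy Ay.
have := uy Ay; have := vy Ay; lra.
Qed.

Lemma lsc_on_continuous A u : continuous u -> lsc_on A u.
Proof.
move=> cu x Ax e e0; have /cvgrPdist_lt /(_ _ e0) := cu x.
by apply: filterS => y; rewrite ltr_norml => /andP[_ ?] _; lra.
Qed.

Lemma nnseries_lt_pinfty_bound (p : nat -> R) (M : R) : (forall n, 0 <= p n) ->
  (forall n, \sum_(0 <= k < n) p k <= M) ->
  (\sum_(0 <= n <oo) (p n)%:E < +oo)%E.
Proof.
move=> p0 pM; apply: (@le_lt_trans _ _ M%:E); last by rewrite ltry.
apply: lime_le; first by apply: is_cvg_nneseries => n _ _; rewrite lee_fin.
by apply: nearW => n; rewrite sumEFin lee_fin.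
Qed.

Lemma nnseries_partial_le (p : nat -> R) n : (forall n, 0 <= p n) ->
  cvgn (series p) -> series p n <= limn (series p).
Proof.
move=> p0 cp; apply: nondecreasing_cvgn_le => //.
by apply/nondecreasing_seqP => m; rewrite /series /= big_nat_recr //= lerDl.
Qed.

Lemma lsc_on_nnseries (p : nat -> K -> R) :
  (forall n, continuous (p n)) -> (forall n x, 0 <= p n x) ->
  (forall x, cvgn (series (p ^~ x))) ->
  lsc_on setT (fun x => limn (series (p ^~ x))).
Proof.
move=> pc p0 cp x _ e e0; have e20 : 0 < e / 2 by rewrite divr_gt0.
have /cvgrPdist_lt /(_ _ e20) [N _ /(_ N (leqnn N))] := cp x.
rewrite ltr_norml => /andP[_ H].
have cs : continuous (fun y => series (p ^~ y) N).
  move=> y; rewrite /series /=; elim: N {H} => [|n IH].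
    by under eq_fun do rewrite big_nil; exact: cvg_cst.
  under eq_fun do rewrite big_nat_recr //=.
  by apply: cvgD => //; exact: pc.
have /cvgrPdist_lt /(_ _ e20) := cs x.
apply: filterS => y; rewrite ltr_norml => /andP[_ H'] _.
have := nnseries_partial_le N (p0^~ y) (cp y); lra.
Qed.

(** The positive and the negative parts of the increments of an approximating
    sequence sum up to two lower semicontinuous functions. *)
Lemma DSC_lsc (f : K -> R) : DSC f -> exists a b : K -> R,
  [/\ lsc_on setT a, lsc_on setT b & forall x, f x = a x - b x].
Proof.
move=> [u [uc uf us]].
pose d n x := u n.+1 x - u n x.
have dc n : continuous (d n) by move=> x; apply: cvgB; exact: uc.
(* The positive part is the case [s = 1], the negative one is [s = -1]. *)
have half (s : R) : `|s| = 1 -> exists p : nat -> K -> R,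
    (forall n x, p n x = (`|d n x| + s * d n x) / 2) /\
    [/\ forall n, continuous (p n), forall n x, 0 <= p n x &
      forall x, cvgn (series (p ^~ x))].
  move=> s1; exists (fun n x => (`|d n x| + s * d n x) / 2); split=> //.
  have p0 n x : 0 <= (`|d n x| + s * d n x) / 2.
    apply: divr_ge0 => //; have := ler_norm (- (s * d n x)).
    rewrite normrN normrM s1 mul1r; lra.
  split=> // [n x|x].
    apply: cvgM; last exact: cvg_cst.
    apply: cvgD; first by apply: cvg_norm; exact: dc.
    by apply: cvgM; [exact: cvg_cst|exact: dc].
  apply: (@series_le_cvg _ _ (fun n => `|d n x|)) => // [n|].
    have := ler_norm (s * d n x); rewrite normrM s1 mul1r; lra.
  by apply: nnseries_is_cvg => //; exact: us.
have [p [pE [pc p0 pcv]]] := half 1 (normr1 _).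
have [q [qE [qc q0 qcv]]] := half (-1) (normrN1 _).
exists (fun x => u 0%N x + limn (series (p ^~ x))),
  (fun x => limn (series (q ^~ x))).
split; [|exact: lsc_on_nnseries|move=> x].
  by apply: lsc_onD; [exact: lsc_on_continuous|exact: lsc_on_nnseries].
apply: (@cvg_unique _ (@Rhausdorff R) (u ^~ x @ \oo)); first exact: uf.
have -> : u ^~ x = fun n => u 0%N x + series (p ^~ x) n - series (q ^~ x) n.
  apply/funext; elim=> [|n IH]; first by rewrite /series /= !big_nil; lra.
  move: IH; rewrite /series /= !big_nat_recr //= pE qE /d; lra.
by apply: cvgB; [apply: cvgD; [exact: cvg_cst|exact: pcv]|exact: qcv].
Qed.

End LowerSemicontinuity.

Section InfConvolution.
Variables (R : realType) (K : topologicalType) (d : K -> K -> R).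
Hypothesis dist : distance_on d.
Hypothesis dtop : distance_induces_topology d.
Variable u : K -> R.
Hypotheses (u0 : forall x, 0 <= u x) (ulsc : lsc_on setT u).

Let d0 x y : 0 <= d x y. Proof. by have [] := dist. Qed.
Let dxx x : d x x = 0. Proof. by have [_ H _ _] := dist; apply/H. Qed.
Let dC x y : d x y = d y x. Proof. by have [] := dist. Qed.
Let dtri x y z : d x z <= d x y + d y z. Proof. by have [] := dist. Qed.

(** The inf-convolution of [u] with [n] times the distance. *)
Definition inf_conv (n : nat) (x : K) : R :=
  inf (range (fun y => u y + n%:R * d x y)).

Let lb n x : has_lbound (range (fun y => u y + n%:R * d x y)).
Proof. by exists 0 => _ [y _ <-]; rewrite addr_ge0 // mulr_ge0. Qed.

Lemma inf_conv_le n x y : inf_conv n x <= u y + n%:R * d x y.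
Proof. by apply: ge_inf; [exact: lb|exists y]. Qed.

Lemma le_inf_conv n x c :
  (forall y, c <= u y + n%:R * d x y) -> c <= inf_conv n x.
Proof.
move=> H; apply: lb_le_inf; last by move=> _ [y _ <-].
by exists (u x + n%:R * d x x), x.
Qed.

Lemma inf_conv_le_self n x : inf_conv n x <= u x.
Proof. by have := inf_conv_le n x x; rewrite dxx mulr0 addr0. Qed.

Lemma inf_conv_nondecreasing n x : inf_conv n x <= inf_conv n.+1 x.
Proof.
apply: le_inf_conv => y; apply: le_trans (inf_conv_le n x y) _.
by rewrite lerD2l ler_wpM2r // ler_nat.
Qed.

Lemma inf_conv_lipschitz n x y : inf_conv n x <= inf_conv n y + n%:R * d x y.
Proof.
rewrite -lerBlDr; apply: le_inf_conv => z; rewrite lerBlDr.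
apply: le_trans (inf_conv_le n x z) _; rewrite -addrA lerD2l -mulrDr.
by rewrite ler_wpM2l // addrC.
Qed.

Lemma inf_conv_continuous n : continuous (inf_conv n).
Proof.
move=> x; apply/cvgrPdist_lt => e e0; apply/dtop.
exists (e / n.+1%:R); first by rewrite divr_gt0.
move=> y /=; rewrite ltr_pdivlMr // => dxy.
have := inf_conv_lipschitz n x y; have := inf_conv_lipschitz n y x.
rewrite (dC y x) ltr_norml.
have : n%:R * d x y <= d x y * n.+1%:R by rewrite mulrC ler_wpM2l // ler_nat.
move: (n%:R * d x y) dxy => t ? ? ? ?; apply/andP; split; lra.
Qed.

Lemma inf_conv_cvg x : inf_conv ^~ x @ \oo --> u x.
Proof.
apply/cvgrPdist_le => e e0.
have := @ulsc x I e e0; rewrite /= => /dtop[r r0 ur].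
(* From this rank on, points at distance at least [r] from [x] cost more than
   [u x]; points nearer than [r] have values above [u x - e]. *)
exists (Num.truncn (u x / r)).+1 => // n /= Nn.
rewrite ler_norml; apply/andP; split.
  by have := inf_conv_le_self n x; lra.
suff : u x - e <= inf_conv n x by lra.
apply: le_inf_conv => y; have [dxy|dxy] := ltP (d x y) r.
  have := ur y dxy I; have : 0 <= n%:R * d x y by rewrite mulr_ge0.
  lra.
have : u x < n%:R * d x y.
  apply: (@lt_le_trans _ _ (n%:R * r)); last by rewrite ler_wpM2l.
  rewrite -ltr_pdivrMr //.
  apply: lt_le_trans (_ : (Num.truncn (u x / r)).+1%:R <= _).
    exact: truncnS_gt.
  by rewrite ler_nat.
have := u0 y; lra.
Qed.

End InfConvolution.

(** The inf-convolutions of [u] and of [v] increase, so that the increments of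
    their difference have absolute values of sum at most [u x + v x] at [x]. *)
Lemma lsc_DSC (R : realType) (K : topologicalType) (d : K -> K -> R)
    (f u v : K -> R) :
  distance_on d -> distance_induces_topology d ->
  (forall x, 0 <= u x) -> (forall x, 0 <= v x) ->
  lsc_on setT u -> lsc_on setT v -> (forall x, f x = u x - v x) -> DSC f.
Proof.
move=> dd dt u0 v0 lu lv fE.
pose U := inf_conv d u; pose V := inf_conv d v.
exists (fun n x => U n x - V n x); split.
- by move=> n x; apply: cvgB; exact: inf_conv_continuous.
- by move=> x; rewrite fE; apply: cvgB; exact: inf_conv_cvg.
- move=> x; apply: (@nnseries_lt_pinfty_bound _ _ (u x + v x)) => // n.
  apply: (@le_trans _ _ ((U n x + V n x) - (U 0%N x + V 0%N x))).
    rewrite -[leRHS](@telescope_sumr _ 0 n (fun k => U k x + V k x)) //.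
    apply: ler_sum => k _.
    have := inf_conv_nondecreasing dd u0 k x.
    have := inf_conv_nondecreasing dd v0 k x.
    rewrite -/U -/V ler_norml => ? ?; apply/andP; split; lra.
  have := inf_conv_le_self dd u0 n x; have := inf_conv_le_self dd v0 n x.
  have : 0 <= U 0%N x by apply: le_inf_conv => y; rewrite mul0r addr0.
  have : 0 <= V 0%N x by apply: le_inf_conv => y; rewrite mul0r addr0.
  rewrite -/U -/V; lra.
Qed.

(** * Gluing bounded pieces *)

Section Pieces.
Variables (R : realType) (K : topologicalType) (f : K -> R).

(** A closed set on which [f] is a difference of bounded nonnegative lower
    semicontinuous functions. *)
Definition dbsc_piece (C : set K) := closed C /\ exists (M : R) (u v : K -> R),
  [/\ forall x, C x -> [/\ 0 <= u x <= M, 0 <= v x <= M & f x = u x - v x],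
      lsc_on C u & lsc_on C v].

(** A set covered by countably many such pieces. *)
Definition sigma_piece (A : set K) :=
  exists C : nat -> set K, (forall n, dbsc_piece (C n)) /\ A `<=` \bigcup_n C n.

Lemma sigma_piece_bigcup (A : nat -> set K) :
  (forall n, sigma_piece (A n)) -> sigma_piece (\bigcup_n A n).
Proof.
move=> /choice[C HC].
exists (fun k => if unpickle k is Some (n, m) then C n m else set0); split.
  move=> k; case: unpickle => [[n m]|]; first by have [] := HC n.
  split; first exact: closed0.
  by exists 0, (fun=> 0), (fun=> 0); split.
move=> x [n _ Ax]; have [_ /(_ _ Ax)[m _ Cx]] := HC n.
by exists (pickle (n, m)); rewrite ?pickleK.
Qed.

Lemma sigma_piece_sub (A B : set K) :
  A `<=` B -> sigma_piece B -> sigma_piece A.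
Proof. by move=> AB [C [Cg BC]]; exists C; split=> // x /AB /BC. Qed.

Lemma sigma_piece_setU (A B : set K) :
  sigma_piece A -> sigma_piece B -> sigma_piece (A `|` B).
Proof.
move=> sA sB; pose D n := if n is 0%N then A else B.
apply: (@sigma_piece_sub _ (\bigcup_n D n)).
  by move=> x [Ax|Bx]; [exists 0%N|exists 1%N].
by apply: sigma_piece_bigcup => -[|n].
Qed.

(** With [N x] the first index of a piece containing [x], the glued functions
    are [u (N x) x + c (N x)] and [v (N x) x + c (N x)].  Points near [x] have an
    index at least [N x], and where the index is larger the constant [c] has
    grown by at least the bound on the piece of [x], so lower semicontinuity
    persists. *)
Lemma sigma_piece_lsc (C : nat -> set K) :
  (forall n, dbsc_piece (C n)) -> setT `<=` \bigcup_n C n ->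
  exists u v : K -> R, [/\ forall x, 0 <= u x, forall x, 0 <= v x,
    lsc_on setT u, lsc_on setT v & forall x, f x = u x - v x].
Proof.
move=> Cg Ccov; have Ccl n : closed (C n) by have [] := Cg n.
have /choice[MM HM] n : exists t : R * ((K -> R) * (K -> R)),
  [/\ forall x, C n x -> [/\ 0 <= t.2.1 x <= t.1, 0 <= t.2.2 x <= t.1 &
                             f x = t.2.1 x - t.2.2 x],
      lsc_on (C n) t.2.1 & lsc_on (C n) t.2.2].
  by have [_ [M [u [v H]]]] := Cg n; exists (M, (u, v)).
pose M n := Num.max 0 (MM n).1; pose u n := (MM n).2.1; pose v n := (MM n).2.2.
have M0 n : 0 <= M n by rewrite /M le_max lexx.
have /choice[N HN] x : exists n, C n x /\ forall m, (m < n)%N -> ~ C m x.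
  have ex : exists n, `[< C n x >].
    by have [n _ Cn] := Ccov x I; exists n; exact/asboolP.
  exists (ex_minn ex); case: ex_minnP => n /asboolP Cn nmin; split=> // m mn Cm.
  by have := nmin m (asboolT Cm); rewrite leqNgt mn.
pose c n := \sum_(0 <= i < n) M i.
have c_mono n m : (n < m)%N -> c n + M n <= c m.
  move=> nm; rewrite /c [leRHS](@big_cat_nat _ _ _ n.+1) //=.
  rewrite big_nat_recr //= lerDl.
  by apply: sumr_ge0.
have c0 n : 0 <= c n by apply: sumr_ge0.
have lsc (w : nat -> K -> R) : (forall n x, C n x -> 0 <= w n x <= M n) ->
    (forall n, lsc_on (C n) (w n)) ->
    lsc_on setT (fun x => w (N x) x + c (N x)).
  move=> wM wl x _ e e0; have [Cx nCx] := HN x.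
  have away : \forall y \near x, forall m, (m < N x)%N -> ~ C m y.
    move: (N x) nCx => n {Cx}; elim: n => [|n IH] nC; first by apply: nearW.
    have near_n : \forall y \near x, ~ C n y.
      by apply: open_nbhs_nbhs; split; [exact: closed_openC|exact: nC].
    apply: filterS2 (IH (fun m mn => nC m (ltnW mn))) near_n => y H1 H2 m.
    by rewrite ltnS leq_eqVlt => /orP[/eqP->|/H1].
  apply: filterS2 away (wl _ _ Cx _ e0) => y aw wy _.
  have [Cy _] := HN y.
  have [Nlt|Ngt|Neq] := ltngtP (N x) (N y).
  - have := c_mono _ _ Nlt.
    have /andP[_] := wM _ _ Cx; have /andP[+ _] := wM _ _ Cy; lra.
  - by exfalso; exact: (aw _ Ngt).
  - by rewrite -Neq in Cy *; have := wy Cy; lra.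
have uM n x : C n x -> 0 <= u n x <= M n.
  move=> Cx; have [+ _ _] := HM n => /(_ x Cx)[/andP[-> h] _ _] /=.
  by rewrite /M le_max h orbT.
have vM n x : C n x -> 0 <= v n x <= M n.
  move=> Cx; have [+ _ _] := HM n => /(_ x Cx)[_ /andP[-> h] _] /=.
  by rewrite /M le_max h orbT.
exists (fun x => u (N x) x + c (N x)), (fun x => v (N x) x + c (N x)); split.
- move=> x; rewrite addr_ge0 //; have [Cx _] := HN x.
  by have /andP[] := uM _ _ Cx.
- move=> x; rewrite addr_ge0 //; have [Cx _] := HN x.
  by have /andP[] := vM _ _ Cx.
- by apply: lsc => // n; have [_ h _] := HM n.
- by apply: lsc => // n; have [_ _ h] := HM n.
- move=> x; have [Cx _] := HN x; have [+ _ _] := HM (N x) => /(_ x Cx)[_ _ ->].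
  rewrite /u /v; lra.
Qed.

End Pieces.

Section Metric.
Variables (R : realType) (K : topologicalType) (d : K -> K -> R).
Hypothesis dist : distance_on d.
Hypothesis dtop : distance_induces_topology d.

Let dxx x : d x x = 0. Proof. by have [_ H _ _] := dist; apply/H. Qed.
Let dC x y : d x y = d y x. Proof. by have [] := dist. Qed.
Let dtri x y z : d x z <= d x y + d y z. Proof. by have [] := dist. Qed.

Lemma near_dist_lt z y r : d z y < r -> \forall t \near y, d z t < r.
Proof.
move=> zy; apply/dtop; exists (r - d z y); first by rewrite subr_gt0.
by move=> t /= yt; have := dtri z y t; lra.
Qed.

Lemma near_dist_gt z y r : r < d z y -> \forall t \near y, r < d z t.
Proof.
move=> zy; apply/dtop; exists (d z y - r); first by rewrite subr_gt0.
by move=> t /= yt; have := dtri z t y; rewrite (dC t y); lra.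
Qed.

(** Balls of radius [1 / (k + 1)] centred at the points of [D] form a base; they
    are numbered through an injection of [D] into the natural numbers. *)
Lemma metric_countable_base (D : set K) : countable D -> dense D ->
  exists B : nat -> set K, (forall n x, B n x -> nbhs x (B n)) /\
    forall x A, nbhs x A -> exists n, B n x /\ B n `<=` A.
Proof.
move=> /countable_injP[g ginj] Ddense.
pose b (p : nat * nat) : set K :=
  [set y | exists x, [/\ D x, g x = p.1 & d x y < p.2.+1%:R^-1]].
exists (fun n => if unpickle n is Some p then b p else set0); split.
  move=> n x; case: unpickle => // p [z [Dz gz zx]].
  by apply: filterS (near_dist_lt zx) => y zy; exists z.
move=> x A /dtop[e e0 eA].
have e20 : 0 < e / 2 by rewrite divr_gt0.
have [k _ ke] := near_infty_natSinv_lt (PosNum e20).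
have {ke} ke := ke k (leqnn k).
have k0 : 0 < k.+1%:R^-1 :> R by rewrite invr_gt0 ltr0n.
pose W := [set y | d x y < k.+1%:R^-1].
have oW : open W.
  by rewrite openE => y yW; exact: near_dist_lt.
have [z [Wz Dz]] : W `&` D !=set0.
  by apply: Ddense => //; exists x; rewrite /W /= dxx.
exists (pickle (g z, k)); rewrite pickleK; split.
  by exists z; split=> //; rewrite dC.
move=> y [z' [Dz' gz' zy]]; apply: eA => /=.
have {gz'} zz' : z' = z by apply: ginj; rewrite ?inE.
subst z'; have := dtri x z y; move: ke Wz zy; rewrite /W /=.
by move: (k.+1%:R^-1 : R) => t; lra.
Qed.

(** If [f] is a difference of lower semicontinuous functions [u] and [v] on
    [W `&` L], for a neighborhood [W] of a point [x0] of the closed set [L], then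
    near [x0] the set [L] is covered by pieces: [u] and [v] are bounded below
    near [x0], and their sublevel sets are relatively closed. *)
Lemma portion_sigma_piece (f u v : K -> R) (L W : set K) (x0 : K) :
  closed L -> nbhs x0 W -> L x0 ->
  (forall x, W x -> L x -> f x = u x - v x) ->
  lsc_on (W `&` L) u -> lsc_on (W `&` L) v ->
  exists2 V, nbhs x0 V & sigma_piece f (V `&` L).
Proof.
move=> cL Wx0 Lx0 fE lu lv.
have WLx0 : (W `&` L) x0 by split=> //; exact: nbhs_singleton.
have [r r0 rW] := proj1 (dtop _ _) (filterI Wx0
  (filterI (lu _ WLx0 _ ltr01) (lv _ WLx0 _ ltr01))).
have r20 : 0 < r / 2 by rewrite divr_gt0.
(* Adding [m] makes [u] and [v] nonnegative on the part of [L] in the ball of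
   radius [r], where they exceed [u x0 - 1] and [v x0 - 1]. *)
pose m := `|u x0| + `|v x0| + 1.
have um y : d x0 y <= r / 2 -> L y -> 0 <= u y + m /\ 0 <= v y + m.
  move=> dy Ly; have [|Wy [uy vy]] := rW y; first by rewrite /=; lra.
  have := uy (conj Wy Ly); have := vy (conj Wy Ly).
  have := ler_norm (- u x0); have := ler_norm (- v x0).
  have := normr_ge0 (u x0); have := normr_ge0 (v x0).
  rewrite !normrN /m; lra.
pose C n :=
  [set y | [/\ L y, d x0 y <= r / 2, u y + m <= n%:R & v y + m <= n%:R]].
exists [set y | d x0 y <= r / 2].
  have : d x0 x0 < r / 2 by rewrite dxx.
  by move=> /near_dist_lt; apply: filterS => y /= /ltW.
have CWL n y : C n y -> (W `&` L) y.
  by move=> [Ly dy _ _]; split=> //; have [|//] := rW y; rewrite /=; lra.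
exists C; split; last first.
  move=> y [/= dy Ly].
  exists (Num.truncn (Num.max (u y + m) (v y + m))).+1 => //.
  have := truncnS_gt (Num.max (u y + m) (v y + m)).
  by rewrite gt_max => /andP[/ltW ? /ltW ?].
move=> n; split.
  move=> y clC.
  have Ly : L y by apply: cL => A /clC[z [[Lz _ _ _] Az]]; exists z.
  have dy : d x0 y <= r / 2.
    rewrite leNgt; apply/negP => /near_dist_gt /clC[z [[_ dz _ _] /=]]; lra.
  have WLy : (W `&` L) y.
    by split=> //; have [|//] := rW y; rewrite /=; lra.
  have bound w : lsc_on (W `&` L) w -> (forall z, C n z -> w z + m <= n%:R) ->
      w y + m <= n%:R.
    move=> lw wn; rewrite leNgt; apply/negP => yn.
    have e0 : 0 < w y + m - n%:R by rewrite subr_gt0.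
    have [z [Cz /=]] := clC _ (lw _ WLy _ e0).
    have := wn _ Cz; have := CWL _ _ Cz => h1 h2 /(_ h1); lra.
  by split=> //; apply: bound => // z [].
exists n%:R, (fun x => u x + m), (fun x => v x + m); split.
- move=> x Cx; have [Lx dx ux vx] := Cx; have [u0 v0] := um _ dx Lx.
  have [Wx _] := CWL _ _ Cx.
  by split; [apply/andP|apply/andP|rewrite fE //; lra].
- apply: lsc_onD; last by apply: lsc_on_continuous => z; exact: cvg_cst.
  by apply: lsc_on_sub lu; exact: CWL.
- apply: lsc_onD; last by apply: lsc_on_continuous => z; exact: cvg_cst.
  by apply: lsc_on_sub lv; exact: CWL.
Qed.

(** The union of the basic open sets covered by countably many pieces is the
    whole space: a point of a non-empty portion of its complement that is so
    covered would have a basic neighborhood covered by countably many pieces. *)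
Lemma DSC_of_portions (f : K -> R) (D : set K) : countable D -> dense D ->
  (forall L, closed L -> L !=set0 ->
    exists x V, [/\ L x, nbhs x V & sigma_piece f (V `&` L)]) ->
  DSC f.
Proof.
move=> cD dD H; have [B [Bnbhs Bbase]] := metric_countable_base cD dD.
pose A n := if pselect (sigma_piece f (B n)) is left _ then B n else set0.
have sA n : sigma_piece f (A n).
  rewrite /A; case: pselect => // ns; exists (fun=> set0); split=> // _.
  by split; [exact: closed0|exists 0, (fun=> 0), (fun=> 0); split].
have AE n x : B n x -> sigma_piece f (B n) -> (\bigcup_n A n) x.
  by move=> Bx sB; exists n => //; rewrite /A; case: pselect.
have sU := sigma_piece_bigcup sA.
have AT : setT `<=` \bigcup_n A n.
  apply: contrapT => nT.
  have [x xU] : exists x, ~ (\bigcup_n A n) x.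
    by apply/existsNP => h; apply: nT => x _.
  have oU : open (\bigcup_n A n).
    apply: bigcup_open => n _; rewrite openE => y Ay.
    rewrite /A in Ay *; case: pselect Ay => // sB Ay; exact: Bnbhs.
  have [||y [V [Ly /Bbase[n [Bny BV]] sV]]] := H (~` \bigcup_n A n).
  - exact: open_closedC.
  - by exists x.
  - apply: Ly; apply: (AE n) => //.
    apply: sigma_piece_sub (sigma_piece_setU sU sV) => z /BV Vz.
    by have [|] := pselect ((\bigcup_n A n) z); [left|right].
have [C [Cg AC]] := sU.
have [u [v [u0 v0 lu lv fE]]] := sigma_piece_lsc Cg (fun x _ => AC x (AT x I)).
exact: (lsc_DSC dist dtop u0 v0 lu lv fE).
Qed.

End Metric.

(** * Summing the variations *)

Section Assembly.
Variables (R : realType) (K : topologicalType).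
Implicit Types U : set K.

Lemma uniform_cvg_dist U (F : nat -> K -> R) (f : K -> R) (e : R) :
  {uniform U, F @ \oo --> f} -> 0 < e ->
  \forall n \near \oo, forall x, U x -> `|f x - F n x| < e.
Proof.
move=> Ff e0; apply: (Ff [set h | forall x, U x -> `|f x - h x| < e]).
by apply/uniform_nbhs; exists [set xy | ball xy.1 e xy.2]; split;
  [exact: (@entourage_ball R R (PosNum e0))|].
Qed.

(** The Weierstrass M-test. *)
Lemma weierstrass_sum U (G : nat -> K -> R) (M : nat -> R) :
  (forall j x, U x -> `|G j x| <= M j) -> (forall j, 0 <= M j) ->
  (\sum_(0 <= j <oo) (M j)%:E < +oo)%E ->
  exists S : K -> R, forall e, 0 < e ->
    \forall n \near \oo, forall x, U x -> `|S x - \sum_(0 <= j < n) G j x| <= e.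
Proof.
move=> GM M0 /(nnseries_is_cvg M0) cM.
exists (fun x => limn (series (G ^~ x))) => e e0.
have /cvgrPdist_lt /(_ _ e0) := cM; apply: filterS => n.
rewrite ltr_norml => /andP[_ Mn] x Ux.
have cG : cvgn (series (G ^~ x)).
  apply: normed_cvg; apply: (series_le_cvg _ M0 _ cM) => j /=; last exact: GM.
  exact: normr_ge0.
apply/ler_addgt0Pr => t t0.
have /cvgrPdist_lt /(_ _ t0) [m _ /(_ (n + m)%N (leq_addl _ _))] := cG.
have : `|\sum_(n <= j < n + m) G j x| <= \sum_(n <= j < n + m) M j.
  by apply: le_trans (ler_norm_sum _ _ _) _; apply: ler_sum => j _; exact: GM.
have := nnseries_partial_le (n + m) M0 cM.
have := ler_normD (limn (series (G ^~ x)) - series (G ^~ x) (n + m)%N)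
  (\sum_(n <= j < n + m) G j x).
rewrite /series /= in Mn *.
rewrite (big_cat_nat (n := n) _ (leq_addr _ _)) //= ?leq_addr //.
rewrite [X in _ -> X <= _ -> _](@big_cat_nat _ _ _ n) //= ?leq_addr //.
set a := limn _; set b := \sum_(0 <= _ < n) G _ x.
set c := \sum_(n <= _ < _) G _ x.
have -> : a - (b + c) + c = a - b by rewrite opprD addrA subrK.
lra.
Qed.

(** The bounds on the variation of the increments near [x] add up to a bound on
    the variation of [g n - g 0]. *)
Lemma variation_sum (L : set K) (x : K) (g G : nat -> K -> R) : L x ->
  (forall j e, 0 < e -> \forall y \near x, L y ->
     `|(g j.+1 y - g j y) - (g j.+1 x - g j x)| + G j y < G j x + e) ->
  forall n e, 0 < e -> \forall y \near x, L y ->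
    `|(g n y - g 0%N y) - (g n x - g 0%N x)| + \sum_(0 <= j < n) G j y
      < \sum_(0 <= j < n) G j x + e.
Proof.
move=> Lx H; elim=> [|n IH] e e0.
  by apply: nearW => y _; rewrite !big_nil !subrr normr0 !add0r.
have e20 : 0 < e / 2 by rewrite divr_gt0.
apply: filterS2 (IH _ e20) (H n _ e20) => y h1 h2 Ly.
rewrite !big_nat_recr //=; have := h1 Ly; have := h2 Ly.
have := ler_normD ((g n.+1 y - g n y) - (g n.+1 x - g n x))
  ((g n y - g 0%N y) - (g n x - g 0%N x)).
set t := _ + _; have -> : t = (g n.+1 y - g 0%N y) - (g n.+1 x - g 0%N x).
  rewrite /t; lra.
lra.
Qed.

(** Let [g n] converge to [f] uniformly on [U], with increments whose local
    variation on [V `&` L] is controlled by summable functions [G j]; then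
    [f - g 0] is a difference of lower semicontinuous functions on [V `&` L]. *)
Lemma variation_limit (L U V : set K) (g : nat -> K -> R) (f : K -> R)
    (G : nat -> K -> R) (M : nat -> R) :
  V `&` L `<=` U -> open V -> {uniform U, g @ \oo --> f} ->
  (forall j x, U x -> `|G j x| <= M j) -> (forall j, 0 <= M j) ->
  (\sum_(0 <= j <oo) (M j)%:E < +oo)%E ->
  (forall j x, V x -> L x -> forall e, 0 < e -> \forall y \near x, L y ->
     `|(g j.+1 y - g j y) - (g j.+1 x - g j x)| + G j y < G j x + e) ->
  exists p q : K -> R, [/\ lsc_on (V `&` L) p, lsc_on (V `&` L) q &
    forall x, f x - g 0%N x = p x - q x].
Proof.
move=> VLU oV gf GM M0 Mfin H.
have [S HS] := weierstrass_sum GM M0 Mfin.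
pose D x := f x - g 0%N x.
have key x : (V `&` L) x -> forall e, 0 < e -> \forall y \near x, (V `&` L) y ->
    `|D y - D x| + S y < S x + e.
  move=> [Vx Lx] e e0; have e80 : 0 < e / 8 by rewrite divr_gt0.
  have [n [gn Sn]] := filter_ex (filterI (uniform_cvg_dist gf e80) (HS _ e80)).
  have := variation_sum Lx (fun j => H j x Vx Lx) n e80.
  apply: filterS => y /[swap] -[Vy Ly] /(_ Ly).
  have Ux : U x by apply: VLU.
  have Uy : U y by apply: VLU.
  have := gn x Ux; have := gn y Uy; have := Sn x Ux; have := Sn y Uy.
  rewrite !ltr_norml !ler_norml => /andP[? ?] /andP[? ?] /andP[? ?] /andP[? ?].
  have : `|D y - D x| <= `|(g n y - g 0%N y) - (g n x - g 0%N x)| + e / 4.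
    have := ler_norm ((g n y - g 0%N y) - (g n x - g 0%N x)).
    have := ler_norm (- ((g n y - g 0%N y) - (g n x - g 0%N x))).
    rewrite normrN ler_norml /D => ? ?; apply/andP; split; lra.
  lra.
(* Both functions are lower semicontinuous because [key] makes [D + S] and
   [S - D] upper semicontinuous. *)
exists (fun x => (D x - S x) / 2), (fun x => (- D x - S x) / 2).
split; last by move=> x; rewrite /D; lra.
- move=> x WLx e e0; apply: filterS (key x WLx _ e0) => y /[apply].
  have := ler_norm (D x - D y); have := ler_norm (D y - D x).
  rewrite distrC; lra.
- move=> x WLx e e0; apply: filterS (key x WLx _ e0) => y /[apply].
  have := ler_norm (D x - D y); have := ler_norm (D y - D x).
  rewrite distrC; lra.
Qed.

End Assembly.

Theorem theorem5p2 (R : realType) (K : topologicalType)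
    (polishK : polish_space R K)
    (f : K -> R) (f_ : nat -> K -> R) (f_DSC : forall n, DSC (f_ n))
    (H : forall (alpha : countable_ordinal) (L : set K),
        closed L -> L !=set0 ->
        exists (phi : nat -> nat) (U : set K),
          [/\ strictly_increasing phi,
              closed_relative_neighborhood L U,
              {uniform U, (fun j => f_ (phi j)) @ \oo --> f} &
              (\sum_(0 <= j <oo)
                 sup_norm (osc (sigL U
                   (fun x => f_ (phi j.+1) x - f_ (phi j) x)%R) alpha)
               < +oo)%E]) :
  DSC f.
Proof.
have [[D cD dD] [d [dist dtop _]]] := polishK.
apply: (DSC_of_portions dist dtop cD dD) => L cL L0.
have [B [_ Bbase]] := metric_countable_base dist dtop cD dD.
have LBbase (x : L) (A : set L) : nbhs x A ->
    exists n, (set_val @^-1` B n) x /\ (set_val @^-1` B n : set L) `<=` A.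
  move=> /nbhs_set_typeP /Bbase[n [Bx BA]].
  by exists n; split=> // y By; apply: (BA _ By).
have [alpha stat] := osc_stationary
  (fun ij : nat * nat => sigL L (fun x => f_ ij.1 x - f_ ij.2 x)) LBbase.
have [phi [U [_ [UL _ [V oV [[x [Vx Lx]] VLU]]] unif sfin]]] := H alpha L cL L0.
pose h j x := f_ (phi j.+1) x - f_ (phi j) x.
pose s j := sup_norm (osc (sigL U (h j)) alpha).
have Ux : U x by apply: VLU.
have s0 j : (0 <= s j)%E.
  apply: le_trans (abse_ge0 _) _; last first.
    by apply: ereal_sup_ubound; exists (SigSub (mem_set Ux) : U).
have sfinj j : s j \is a fin_num.
  rewrite ge0_fin_numE //; apply: le_lt_trans sfin.
  apply: le_trans (nneseries_lim_ge j.+1 _); last by move=> i _ _; exact: s0.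
  by rewrite big_nat_recr //= leeDr //; apply: sume_ge0 => i _; exact: s0.
pose M j := fine (s j).
have ME j : (M j)%:E = s j by rewrite fineK.
have /choice[G HG] j : exists G : K -> R, (forall x, U x -> `|G x| <= M j) /\
    forall x, V x -> L x -> forall e, 0 < e ->
      \forall y \near x, L y -> `|h j y - h j x| + G y < G x + e.
  apply: (portion_osc UL oV VLU (stat (phi j.+1, phi j))).
  by rewrite ME.
have M0 j : 0 <= M j by rewrite fine_ge0.
have Mfin : (\sum_(0 <= j <oo) (M j)%:E < +oo)%E.
  by rewrite (eq_eseriesr (g := s)) // => j _.
have [p [q [lp lq fpq]]] := variation_limit VLU oV unif
  (fun j => (HG j).1) M0 Mfin (fun j => (HG j).2).
have [a [b [la lb fab]]] := DSC_lsc (f_DSC (phi 0%N)).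
have [W Wx sW] : exists2 W, nbhs x W & sigma_piece f (W `&` L).
  apply: (@portion_sigma_piece _ _ _ dist dtop f (fun y => a y + p y)
    (fun y => b y + q y) L V) => //.
  - exact: open_nbhs_nbhs.
  - by move=> y _ _; have := fpq y; have := fab y; lra.
  - by apply: lsc_onD => //; exact: lsc_on_sub la.
  - by apply: lsc_onD => //; exact: lsc_on_sub lb.
by exists x, W.
Qed.
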